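(* For any $w_1,w_2\in\mathfrak{h}_t^0$, we have $$Z_t\big(w_1\overset{t}{\sqcup\!\sqcup} w_2-w_1\overset{t}{\ast} w_2\big)=0.$$
   Context: Let $A=\{x,y\}$ be an alphabet of two noncommutative letters, $A^{\ast}$ the set of words (including the empty word $1$), $\mathfrak{h}_t=\mathbb{Q}[t]\langle A\rangle$, $\mathfrak{h}_t^1=\mathbb{Q}[t]+\mathfrak{h}_ty$, $\mathfrak{h}_t^0=\mathbb{Q}[t]+x\mathfrak{h}_ty$, and $z_k=x^{k-1}y$. For an admissible index $\mathbf{k}=(k_1,\ldots,k_n)$ ($k_1\geqslant2$), $\zeta^t(\mathbf{k})=\sum_{\mathbf{p}}t^{n-\mathrm{dep}(\mathbf{p})}\zeta(\mathbf{p})$, where $\mathbf{p}$ runs over all sequences $(k_1\Box\cdots\Box k_n)$ with each $\Box$ a comma or a plus, and $\zeta$ is the multiple zeta value. $Z_t:\mathfrak{h}_t^0\to\mathbb{R}[t]$ is $\mathbb{Q}[t]$-linear with $Z_t(1)=1$, $Z_t(z_{k_1}\cdots z_{k_n})=\zeta^t(k_1,\ldots,k_n)$. The $t$-shuffle product $\overset{t}{\sqcup\!\sqcup}$ is the $\mathbb{Q}[t]$-bilinear product on $\mathfrak{h}_t$ with $1\overset{t}{\sqcup\!\sqcup} w=w\overset{t}{\sqcup\!\sqcup} 1=w$ and $aw_1\overset{t}{\sqcup\!\sqcup} bw_2=a(w_1\overset{t}{\sqcup\!\sqcup} bw_2)+b(aw_1\overset{t}{\sqcup\!\sqcup} w_2)-\delta(w_1)\rho(a)bw_2-\delta(w_2)\rho(b)aw_1$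 for $w,w_1,w_2\in A^\ast$, $a,b\in A$, where $\delta(w)=1$ if $w=1$ and $0$ otherwise, and $\rho(x)=0$, $\rho(y)=tx$. The $t$-harmonic product $\overset{t}{\ast}$ on $\mathfrak{h}_t^1$ is the $\mathbb{Q}[t]$-bilinear product with $1\overset{t}{\ast} w=w\overset{t}{\ast} 1=w$ and $z_kw_1\overset{t}{\ast} z_lw_2=z_k(w_1\overset{t}{\ast} z_lw_2)+z_l(z_kw_1\overset{t}{\ast} w_2)+(1-2t)z_{k+l}(w_1\overset{t}{\ast} w_2)+(1-\delta(w_1)\delta(w_2))(t^2-t)x^{k+l}(w_1\overset{t}{\ast} w_2)$ for words $w,w_1,w_2\in A^\ast\cap\mathfrak{h}_t^1$ and $k,l\geqslant1$. *)

(* Defs.v *)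
From HB Require Import structures.
From mathcomp Require Import all_boot all_order all_algebra finmap.
(* monalg must come before the analysis files: imported in the other order,
   their notations clash. *)
From mathcomp.multinomials Require Import monalg.
From mathcomp Require Import reals topology normedtype sequences.

Set Implicit Arguments.
Unset Strict Implicit.
Unset Printing Implicit Defensive.

Import GRing.Theory numFieldNormedType.Exports.

Local Open Scope ring_scope.

Inductive letter := X | Y.

Definition is_Y (a : letter) : bool := if a is Y then true else false.
Definition letter_of_bool (b : bool) : letter := if b then Y else X.
Lemma is_YK : cancel is_Y letter_of_bool. Proof. by case. Qed.

HB.instance Definition _ := Countable.copy letter (can_type is_YK).

(* Q[t]<x, y>: the monoid algebra over Q[t] of the free monoid on x, y.
   The variable t is ['X : {poly rat}]. *)
Notation ht := {malg {poly rat}[{fmonom letter}]}.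

Definition word (w : seq letter) : ht := << FMonom w >>.

Definition in_h0 (p : ht) : Prop :=
  exists (c : {poly rat}) (q : ht), p = c%:MP + word [:: X] * q * word [:: Y].

Definition bilinear_ext (f : seq letter -> seq letter -> ht) (p q : ht) : ht :=
  \sum_(u <- msupp p) \sum_(v <- msupp q) (p@_u * q@_v) *: f u v.

Definition delta (T : Type) (w : seq T) : {poly rat} := (nilp w)%:R.

Definition rho (a : letter) : ht := if a is Y then 'X *: word [:: X] else 0.

Fixpoint tshuffle_word (u v : seq letter) {struct u} : ht :=
  if u is a :: w1 then
    (fix aux (v : seq letter) : ht :=
       if v is b :: w2 then
         word [:: a] * tshuffle_word w1 v + word [:: b] * aux w2
         - delta w1 *: (rho a * word v) - delta w2 *: (rho b * word u)
       else word u) v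
  else word v.

Definition tshuffle : ht -> ht -> ht := bilinear_ext tshuffle_word.

Definition z (k : nat) : ht := word (rcons (nseq k.-1 X) Y).

(* On a word of h^1, i.e. an empty word or one ending with y, this is the unique
   sequence (k_1, ..., k_n) of positive integers such that the word is
   z_{k_1} ... z_{k_n}.  On other words the trailing x's are ignored. *)
Definition index_of_word (w : seq letter) : seq nat :=
  (fix aux (k : nat) (w : seq letter) : seq nat :=
     match w with
     | [::] => [::]
     | X :: w' => aux k.+1 w'
     | Y :: w' => k :: aux 1%N w'
     end) 1%N w.

(* [tharmonic_index ks ls] is the t-harmonic product of z_{k_1} ... z_{k_m}
   and z_{l_1} ... z_{l_n}. *)
Fixpoint tharmonic_index (ks ls : seq nat) {struct ks} : ht :=
  if ks is k :: w1 then
    (fix aux (ls : seq nat) : ht :=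
       if ls is l :: w2 then
         z k * tharmonic_index w1 ls + z l * aux w2
         + (1 - 2 * 'X) *: (z (k + l)%N * tharmonic_index w1 w2)
         + ((1 - delta w1 * delta w2) * ('X ^+ 2 - 'X)) *:
             (word (nseq (k + l)%N X) * tharmonic_index w1 w2)
       else \prod_(j <- ks) z j) ls
  else \prod_(j <- ls) z j.

(* Total on h, but meaningful only on h^1: see [index_of_word]. *)
Definition tharmonic : ht -> ht -> ht :=
  bilinear_ext
    (fun u v => tharmonic_index (index_of_word u) (index_of_word v)).

(* The index (k_1 # ... # k_n) where the i-th box # is a plus if the i-th entry
   of [b] is true, and a comma otherwise. *)
Fixpoint fill_from (k : nat) (b : seq bool) (ks : seq nat) : seq nat :=
  match b, ks with
  | true :: b', k' :: ks' => fill_from (k + k')%N b' ks'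
  | false :: b', k' :: ks' => k :: fill_from k' b' ks'
  | _, _ => k :: ks
  end.

Definition fill (b : seq bool) (ks : seq nat) : seq nat :=
  if ks is k :: ks' then fill_from k b ks' else [::].

Section Zeta.
Variable R : realType.

(* sum of m_1^-k_1 ... m_n^-k_n over N >= m_1 > ... > m_n >= 1, where
   m_i = 1 + [tnth m i] *)
Definition mzv_trunc (ks : seq nat) (N : nat) : R :=
  \sum_(m : (size ks).-tuple 'I_N | sorted gtn [seq val j | j <- m])
     \prod_(i < size ks) (tnth m i).+1%:R ^- nth 0%N ks i.

Definition mzv (ks : seq nat) : R := limn (mzv_trunc ks).

Definition zetat (ks : seq nat) : {poly R} :=
  \sum_(b : (size ks).-1.-tuple bool)
     mzv (fill b ks) *: 'X ^+ (size ks - size (fill b ks))%N.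

(* Total on h, but meaningful only on h^0: on the other words the truncated sums
   may diverge or [index_of_word] may be junk. *)
Definition Zt (p : ht) : {poly R} :=
  \sum_(u <- msupp p) map_poly ratr p@_u * zetat (index_of_word u).

End Zeta.

(* Main.v *)
(* Fix a real tau >= 0 and put t = tau.  To a word w attach the sequence c(w) with
   c(1)_n = [n = 0], n c(x w)_n = c(w)_n and
   n c(y w)_n = sum_(m < n) c(w)_m + tau c(w)_n for n > 0.  These are the power
   series coefficients of a tau-deformed multiple polylogarithm, and
   sum_n c(w)_n = zeta^tau(w) for w in h^0.

   Shuffle: Euler's operator f |-> (n f_n)_n is a derivation for the Cauchy
   product and prefixing a letter amounts to a Cauchy product, so by induction
   c(u sh v) is the Cauchy product of c(u) and c(v).  All terms being nonnegative,
   the sums multiply.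

   Harmonic: the partial sums S_n of c satisfy S_n(u * v) = S_n(u) S_n(v) for every
   n, by induction on n and then on the lengths.

   Hence Z_t vanishes on the difference at t = 0, 1, 2, ..., so it is zero as a
   polynomial. *)
Require Import Defs.
From mathcomp Require Import all_boot all_order all_algebra finmap.
From mathcomp.multinomials Require Import monalg.
From mathcomp Require Import reals topology normedtype sequences.
From mathcomp Require Import ring lra.

Set Implicit Arguments.
Unset Strict Implicit.
Unset Printing Implicit Defensive.

Import Order.TTheory GRing.Theory Num.Theory numFieldNormedType.Exports.

Local Open Scope ring_scope.

(** * Functions on words, extended linearly to the free algebra with t specialised to [tau] *)

Section LinearExtension.
Variables (R : realType) (tau : R).
Implicit Types (h : seq letter -> R) (p : ht) (s w : seq letter).

Definition ev : {rmorphism {poly rat} -> R} := horner_eval tau \o map_poly ratr.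

Definition linext (h : seq letter -> R) (p : ht) : R :=
  mmap ev (fun m : {fmonom letter} => h m) p.

Lemma evX : ev 'X = tau.
Proof. by rewrite /= map_polyX /horner_eval hornerX. Qed.

Lemma linextD h : {morph linext h : p q / p + q}.
Proof. exact: mmapD. Qed.

Lemma linextB h : {morph linext h : p q / p - q}.
Proof. exact: mmapB. Qed.

Lemma linext_sum h (I : Type) (r : seq I) (P : pred I) (F : I -> ht) :
  linext h (\sum_(i <- r | P i) F i) = \sum_(i <- r | P i) linext h (F i).
Proof. exact: raddf_sum. Qed.

Lemma linext_U h c m : linext h << c *g m >> = ev c * h m.
Proof. exact: mmapU. Qed.

Lemma linext_word h w : linext h (word w) = h w.
Proof. by rewrite linext_U rmorph1 mul1r. Qed.

Lemma linextZ h c p : linext h (c *: p) = ev c * linext h p.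
Proof.
rewrite [p in LHS]monalgE scaler_sumr linext_sum mulr_sumr.
by apply: eq_bigr => m _; rewrite -mul_malgC malgM_def fgmulUU mul1m linext_U rmorphM mulrA.
Qed.

Lemma word_mul s p :
  word s * p = \sum_(m <- msupp p) << p@_m *g FMonom (s ++ m) >>.
Proof.
rewrite malgM_def fgmulUg; apply: eq_bigr => m _.
by rewrite mul1r; congr (mkmalgU _ _); rewrite /mmul /= fmmulE.
Qed.

Lemma word_cat s (t : seq letter) : word s * word t = word (s ++ t).
Proof. by rewrite malgM_def fgmulUU mul1r /mmul /= fmmulE. Qed.

Lemma word_nil : word [::] = 1.
Proof. by rewrite /word -fmoneE. Qed.

(** Left multiplication by a word is absorbed into the function. Both products are defined by
    prefixing words, so their recursions become recursions on sequences. *)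
Lemma linext_wordM h s p : linext h (word s * p) = linext (fun w => h (s ++ w)) p.
Proof.
by rewrite word_mul linext_sum; apply: eq_bigr => m _; rewrite linext_U.
Qed.

Lemma eq_linext_in h1 h2 p :
  (forall m, m \in msupp p -> h1 m = h2 m) -> linext h1 p = linext h2 p.
Proof. by move=> eqh; apply: eq_big_seq => m /eqh ->. Qed.

Lemma eq_linext h1 h2 : h1 =1 h2 -> linext h1 =1 linext h2.
Proof. by move=> eqh p; apply: eq_linext_in => m _. Qed.

Lemma linext_add h1 h2 p :
  linext (fun w => h1 w + h2 w) p = linext h1 p + linext h2 p.
Proof. by rewrite -big_split; apply: eq_bigr => m _; rewrite mulrDr. Qed.

Lemma linext_scale a h p : linext (fun w => a * h w) p = a * linext h p.
Proof. by rewrite /linext /mmap mulr_sumr; apply: eq_bigr => m _; rewrite mulrCA. Qed.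

Lemma linext_sumr (I : Type) (r : seq I) (h : I -> seq letter -> R) p :
  linext (fun w => \sum_(i <- r) h i w) p = \sum_(i <- r) linext (h i) p.
Proof.
by rewrite exchange_big; apply: eq_bigr => m _; rewrite mulr_sumr.
Qed.

End LinearExtension.

(** * The sequences attached to words, and Cauchy products *)

Section Coefficients.
Variables (R : realType).

(* The value at n = 0 of a nonempty word is 0 because division by 0 gives 0. *)
Fixpoint licoef (tau : R) (w : seq letter) (n : nat) : R :=
  match w with
  | [::] => (n == 0%N)%:R
  | X :: w' => licoef tau w' n / n%:R
  | Y :: w' => (series (licoef tau w') n + tau * licoef tau w' n) / n%:R
  end.

(** The effect of prefixing [a], before the division by n. On generating series in z it is
    multiplication by 1 for x and by z/(1-z) + [tau] for y. *)
Definition letter_op (tau : R) (a : letter) (f : nat -> R) (n : nat) : R :=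
  if a is Y then series f n + tau * f n else f n.

Lemma licoef_cons tau a w n :
  licoef tau (a :: w) n = letter_op tau a (licoef tau w) n / n%:R.
Proof. by case: a. Qed.

Lemma licoef0 tau w : licoef tau w 0 = (nilp w)%:R.
Proof. by case: w => [|a w]//; rewrite licoef_cons invr0 mulr0. Qed.

Lemma licoef_consM tau a w n : (0 < n)%N ->
  n%:R * licoef tau (a :: w) n = letter_op tau a (licoef tau w) n.
Proof.
by move=> n0; rewrite licoef_cons mulrC divfK// pnatr_eq0 -lt0n.
Qed.

Lemma series_ge0 (f : nat -> R) n : (forall m, 0 <= f m) -> 0 <= series f n.
Proof. by move=> f0; apply: sumr_ge0. Qed.

Lemma licoef_ge0 tau w n : 0 <= tau -> 0 <= licoef tau w n.
Proof.
move=> tau0; elim: w n => [|a w IH] n; first exact: ler0n.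
rewrite licoef_cons divr_ge0//; case: a => //=.
by rewrite addr_ge0 ?series_ge0// mulr_ge0.
Qed.

Lemma eq_series (f g : nat -> R) n : f =1 g -> series f n = series g n.
Proof. by move=> fg; apply: eq_bigr. Qed.

Lemma seriesS (f : nat -> R) n : series f n.+1 = series f n + f n.
Proof. by rewrite /series /= big_nat_recr. Qed.

Lemma series0 (f : nat -> R) : series f 0 = 0.
Proof. by rewrite /series /= big_geq. Qed.

Lemma linext_letter_op tau sigma a (p : ht) n :
  linext sigma (fun w => letter_op tau a (licoef tau w) n) p =
  letter_op tau a (fun n => linext sigma (fun w => licoef tau w n) p) n.
Proof.
case: a => //=.
by rewrite linext_add linext_scale linext_sumr.
Qed.

Definition conv (f g : nat -> R) (n : nat) : R :=
  \sum_(i < n.+1) f i * g (n - i)%N.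

Lemma convC f g n : conv f g n = conv g f n.
Proof.
rewrite /conv (reindex_inj rev_ord_inj)/=; apply: eq_bigr => i _.
by rewrite subSS subKn 1?mulrC// -ltnS.
Qed.

Lemma eq_conv f f' g g' n : f =1 f' -> g =1 g' -> conv f g n = conv f' g' n.
Proof. by move=> ff gg; apply: eq_bigr => i _; rewrite ff gg. Qed.

Lemma convDl f f' g n : conv (fun i => f i + f' i) g n = conv f g n + conv f' g n.
Proof. by rewrite -big_split; apply: eq_bigr => i _; rewrite mulrDl. Qed.

Lemma convZl a f g n : conv (fun i => a * f i) g n = a * conv f g n.
Proof. by rewrite /conv mulr_sumr; apply: eq_bigr => i _; rewrite mulrA. Qed.

Lemma conv1l g n : conv (fun i => (i == 0%N)%:R) g n = g n.
Proof.
by rewrite /conv big_ord_recl mul1r subn0 big1 ?addr0// => i _; rewrite mul0r.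
Qed.

(** Partial summation is itself the Cauchy product with z/(1-z), so this is an instance of
    associativity. *)
Lemma conv_series f g n : conv (series f) g n = series (conv f g) n.
Proof.
elim: n => [|n IH]; first by rewrite /conv big_ord1 !series0 mul0r.
rewrite seriesS -IH /conv big_ord_recl series0 mul0r add0r -big_split/=.
by apply: eq_bigr => i _; rewrite subSS seriesS mulrDl.
Qed.

Lemma conv_letter_op tau a f g n :
  conv (letter_op tau a f) g n = letter_op tau a (conv f g) n.
Proof.
by case: a => //=; rewrite convDl convZl conv_series.
Qed.

(** Leibniz rule for Euler's operator: split n as i + (n - i) in each term. *)
Lemma conv_theta f g n :
  n%:R * conv f g n =
  conv (fun i => i%:R * f i) g n + conv f (fun i => i%:R * g i) n.
Proof.
rewrite /conv mulr_sumr -big_split; apply: eq_bigr => i _ /=.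
have {1}-> : n%:R = i%:R + (n - i)%:R :> R by rewrite -natrD subnKC// -ltnS.
by rewrite mulrDl mulrA mulrCA.
Qed.

End Coefficients.

(** * Words occurring in an element of the free algebra *)

Section Support.

Definition supported (P : pred (seq letter)) (p : ht) : Prop :=
  forall m, m \in msupp p -> P m.

Implicit Types (P Q : pred (seq letter)) (p q : ht) (s w : seq letter).

Lemma supported_sub P Q p : subpred P Q -> supported P p -> supported Q p.
Proof. by move=> PQ Pp m /Pp /PQ. Qed.

Lemma supportedD P p q : supported P p -> supported P q -> supported P (p + q).
Proof.
by move=> Pp Pq m /(fsubsetP (msuppD_le _ _)); rewrite in_fsetU => /orP[/Pp|/Pq].
Qed.

Lemma supportedB P p q : supported P p -> supported P q -> supported P (p - q).
Proof. by move=> Pp Pq; apply: supportedD => // m; rewrite msuppN => /Pq. Qed.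

Lemma supportedZ P c p : supported P p -> supported P (c *: p).
Proof. by move=> Pp m /(fsubsetP (msuppZ_le _ _)) /Pp. Qed.

Lemma supported0 P : supported P 0.
Proof. by move=> m; rewrite msupp0 in_fset0. Qed.

Lemma supported_word P w : P w -> supported P (word w).
Proof. by move=> Pw m; rewrite msuppU1 in_fset1 => /eqP ->. Qed.

Lemma supportedM P p q :
  (forall m n, m \in msupp p -> n \in msupp q -> P (m ++ n)) ->
  supported P (p * q).
Proof.
by move=> Ppq _ /msuppM_le[m [n [mp nq ->]]]; rewrite /mmul /= fmmulE; exact: Ppq.
Qed.

Lemma supported_wordM P s p :
  supported (fun w => P (s ++ w)) p -> supported P (word s * p).
Proof.
move=> Pp; apply: supportedM => m n; rewrite msuppU1 in_fset1 => /eqP -> /=.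
exact: Pp.
Qed.

End Support.

(** * The t-shuffle product corresponds to the Cauchy product *)

Section Shuffle.
Implicit Types (u v w : seq letter).

(** The default [Y] of [last] puts the empty word in h^1; the default [X] of [head] in [h0_word]
    likewise keeps it in h^0. *)
Definition h1_word w := is_Y (last Y w).

Definition h0_word w := h1_word w && ~~ is_Y (head X w).

Lemma h1_word_behead a w : h1_word (a :: w) -> h1_word w.
Proof. by case: w. Qed.

Lemma h1_word_cons a w : ~~ nilp w -> h1_word (a :: w) = h1_word w.
Proof. by case: w. Qed.

Lemma h1_word_X w : h1_word (X :: w) -> nilp w = false.
Proof. by case: w. Qed.

Lemma tshuffle_word_nilr u : tshuffle_word u [::] = word u.
Proof. by case: u. Qed.

Lemma tshuffle_word_cons a u b v :
  tshuffle_word (a :: u) (b :: v) =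
    word [:: a] * tshuffle_word u (b :: v)
    + word [:: b] * tshuffle_word (a :: u) v
    - delta u *: (rho a * word (b :: v)) - delta v *: (rho b * word (a :: u)).
Proof. by []. Qed.

Lemma supported_cons (P : pred (seq letter)) a p :
  (forall w, P w -> P (a :: w)) -> supported P p ->
  supported P (word [:: a] * p).
Proof.
by move=> Pa Pp; apply: supported_wordM; apply: supported_sub Pp => w /Pa.
Qed.

Lemma supported_rho (P : pred (seq letter)) a w :
  P (X :: w) -> supported P (rho a * word w).
Proof.
case: a => Pw; first by rewrite mul0r; exact: supported0.
rewrite -scalerAl word_cat; apply: supportedZ; exact: supported_word.
Qed.

(** Prefixing x to the empty word leaves h^1, so the induction must also record that the empty word
    arises only from two empty words. *)
Lemma supported_tshuffle_h1 u v : h1_word u -> h1_word v ->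
  supported (fun w => h1_word w && (nilp w == nilp u && nilp v))
    (tshuffle_word u v).
Proof.
elim: u v => [|a u IHu] v hu.
  by move=> hv; apply: supported_word; rewrite hv /=.
elim: v => [|b v IHv] hv.
  by rewrite tshuffle_word_nilr; apply: supported_word; rewrite hu.
rewrite tshuffle_word_cons /=.
have Pcons c w : h1_word w && (nilp w == false) ->
    h1_word (c :: w) && (nilp (c :: w) == false).
  by case/andP=> hw /eqP/negbT nw; rewrite h1_word_cons// hw.
apply: supportedB; first apply: supportedB; first apply: supportedD.
- apply: supported_cons => [w|]; first exact: Pcons.
  by have := IHu (b :: v) (h1_word_behead hu) hv; rewrite andbF.
- apply: supported_cons => [w|]; first exact: Pcons.
  exact: IHv (h1_word_behead hv).
- by apply/supportedZ/supported_rho; rewrite h1_word_cons// hv.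
- by apply/supportedZ/supported_rho; rewrite h1_word_cons// hu.
Qed.

Lemma supported_tshuffle_h0 u v : h0_word u -> h0_word v ->
  supported h0_word (tshuffle_word u v).
Proof.
case: u => [|a u]; first by move=> _ hv; exact: supported_word.
case: v => [|b v]; first by move=> hu _; exact: supported_word.
case: a; last by rewrite /h0_word andbF.
case: b; last by rewrite /h0_word !andbF.
rewrite /h0_word !andbT => hu hv.
rewrite tshuffle_word_cons !mul0r !scaler0 !subr0.
have nu := h1_word_X hu; have nv := h1_word_X hv.
apply: supportedD; apply: supported_wordM.
- apply: supported_sub (supported_tshuffle_h1 (h1_word_behead hu) hv) => w /=.
  by case/andP=> hw; rewrite andbF => /eqP/negbT nw; rewrite h1_word_cons// hw.
- apply: supported_sub (supported_tshuffle_h1 hu (h1_word_behead hv)) => w /=.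
  by case/andP=> hw /eqP/negbT nw; rewrite h1_word_cons// hw.
Qed.

Variables (R : realType) (tau : R).

Definition rho_coef (a : letter) : R := if a is Y then tau else 0.

(* The correction at n = 0, where the left-hand side vanishes, is what produces the
   two delta terms of the t-shuffle product. *)
Lemma theta_licoef a u n : h1_word (a :: u) ->
  n%:R * licoef tau (a :: u) n =
  letter_op tau a (licoef tau u) n
  + - ((nilp u)%:R * rho_coef a) * (n == 0%N)%:R.
Proof.
case: n => [|n] hu; last by rewrite licoef_consM// mulr0 addr0.
rewrite mul0r mulr1; case: a hu => /= hu.
  by rewrite licoef0 (h1_word_X hu) mul0r oppr0 addr0.
by rewrite series0 licoef0 add0r mulrC subrr.
Qed.

Lemma ev_delta (T : Type) (w : seq T) : ev tau (delta w) = (nilp w)%:R.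
Proof. by rewrite rmorph_nat. Qed.

Lemma linext_rho a v n : (0 < n)%N ->
  n%:R * linext tau (fun w => licoef tau w n) (rho a * word v) =
  rho_coef a * licoef tau v n.
Proof.
case: a => n0; first by rewrite !mul0r /linext mmap0 mulr0.
rewrite -scalerAl word_cat linextZ linext_word evX mulrCA.
by rewrite licoef_consM.
Qed.

Lemma eq_letter_op a (f g : nat -> R) n :
  f =1 g -> letter_op tau a f n = letter_op tau a g n.
Proof. by case: a => fg //=; rewrite fg (eq_series _ fg). Qed.

Lemma linext_consM a p n : (0 < n)%N ->
  n%:R * linext tau (fun w => licoef tau w n) (word [:: a] * p) =
  letter_op tau a (fun n => linext tau (fun w => licoef tau w n) p) n.
Proof.
move=> n0; rewrite linext_wordM -linext_scale -linext_letter_op.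
by apply: eq_linext => w; rewrite licoef_consM.
Qed.

Lemma linext_shuffle_step (x : R) h (p q r s : ht) c d :
  x * linext tau h (p + q - c *: r - d *: s) =
  x * linext tau h p + x * linext tau h q - ev tau c * (x * linext tau h r)
  - ev tau d * (x * linext tau h s).
Proof.
rewrite (linextB _ _ (p + q - c *: r)) (linextB _ _ (p + q)) linextD !linextZ.
by rewrite !mulrBr mulrDr !(mulrCA x).
Qed.

Lemma linext_tshuffle_cons a u b v n : (0 < n)%N ->
  n%:R * linext tau (fun w => licoef tau w n) (tshuffle_word (a :: u) (b :: v)) =
  letter_op tau a
    (fun n => linext tau (fun w => licoef tau w n) (tshuffle_word u (b :: v))) n
  + letter_op tau b
    (fun n => linext tau (fun w => licoef tau w n) (tshuffle_word (a :: u) v)) n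
  - (nilp u)%:R * (rho_coef a * licoef tau (b :: v) n)
  - (nilp v)%:R * (rho_coef b * licoef tau (a :: u) n).
Proof.
move=> n0; rewrite tshuffle_word_cons linext_shuffle_step.
rewrite -(linext_consM a _ n0) -(linext_consM b _ n0).
rewrite -(linext_rho a _ n0) -(linext_rho b _ n0).
rewrite -(ev_delta u).
rewrite -(ev_delta v).
by [].
Qed.

(** After multiplication by n, the Leibniz rule on the left yields the recursion that defines the
    t-shuffle product on the right. *)
Lemma conv_licoef u v n : h1_word u -> h1_word v ->
  conv (licoef tau u) (licoef tau v) n =
  linext tau (fun w => licoef tau w n) (tshuffle_word u v).
Proof.
elim: u v n => [|a u IHu] v n hu; first by move=> _; rewrite linext_word conv1l.
elim: v n => [|b v IHv] n hv.
  by rewrite tshuffle_word_nilr linext_word convC conv1l.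
(* At n = 0 there is no factor n to cancel, but both sides vanish: every word of the product is
   nonempty. *)
have [->|n0] := posnP n.
  rewrite /conv big_ord1 licoef0 mul0r (@eq_linext_in _ _ _ (fun=> 0)).
    by rewrite /linext /mmap big1// => m _; rewrite mulr0.
  move=> m /(supported_tshuffle_h1 hu hv) /andP[_]; rewrite licoef0.
  by move=> /eqP ->.
have n_neq0 : n%:R != 0 :> R by rewrite pnatr_eq0 -lt0n.
apply: (mulfI n_neq0); rewrite conv_theta.
rewrite (eq_conv _ (fun i => theta_licoef i hu) (frefl _)).
rewrite [X in _ + X]convC (eq_conv _ (fun i => theta_licoef i hv) (frefl _)).
(* The corrections in [theta_licoef] are multiples of the unit of the Cauchy product, so they return
   the other factor unchanged. *)
rewrite !convDl !convZl !conv1l !conv_letter_op.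
rewrite (linext_tshuffle_cons a u b v n0).
rewrite (eq_letter_op a _ (fun i => IHu _ i (h1_word_behead hu) hv)).
rewrite (eq_letter_op b
  (g := fun i => linext tau (fun w => licoef tau w i) (tshuffle_word (a :: u) v)));
  last first.
  by move=> i; rewrite convC; exact: IHv (h1_word_behead hv).
by rewrite !mulNr -!mulrA addrACA addrA.
Qed.

End Shuffle.

(** * Indices as words, and the t-harmonic product on partial sums *)

Section Harmonic.
Implicit Types (ks ls : seq nat) (u v w : seq letter) (p : ht).

Definition zword (k : nat) : seq letter := rcons (nseq k.-1 X) Y.

Definition word_of_index ks : seq letter := flatten (map zword ks).

Lemma prod_z ks : \prod_(j <- ks) z j = word (word_of_index ks).
Proof.
elim: ks => [|k ks IH]; first by rewrite big_nil word_nil.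
by rewrite big_cons IH /z word_cat.
Qed.

(* The fixpoint local to [index_of_word]. *)
Fixpoint index_from (k : nat) (w : seq letter) : seq nat :=
  match w with
  | [::] => [::]
  | X :: w' => index_from k.+1 w'
  | Y :: w' => k :: index_from 1%N w'
  end.

Lemma index_of_wordE w : index_of_word w = index_from 1 w.
Proof. by []. Qed.

(** The counter [k] stands for [k.-1] letters x already read, which have to be restored in front of
    [w]. *)
Lemma index_fromK k w : (0 < k)%N -> h1_word w -> ~~ nilp w ->
  word_of_index (index_from k w) = nseq k.-1 X ++ w.
Proof.
elim: w k => // -[] w IH k k0 hw _ /=.
  rewrite IH ?(h1_word_behead hw) ?(h1_word_X hw)//.
  by case: k k0 => // k _ /=; elim: k => //= k <-.
rewrite -[LHS]/(rcons (nseq k.-1 X) Y ++ word_of_index (index_from 1 w)).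
rewrite cat_rcons; congr (_ ++ _ :: _).
by case: (boolP (nilp w)) => [/nilP -> //|nw]; rewrite IH ?(h1_word_behead hw).
Qed.

Lemma index_of_wordK w : h1_word w -> word_of_index (index_of_word w) = w.
Proof.
by case: (boolP (nilp w)) => [/nilP -> //|nw hw]; rewrite index_of_wordE index_fromK.
Qed.

Lemma index_from_gt0 k w : (0 < k)%N -> all (ltn 0) (index_from k w).
Proof. by elim: w k => // -[] w IH k k0 /=; rewrite ?k0 ?IH. Qed.

Lemma index_from_head k w : (k <= head k (index_from k w))%N.
Proof.
elim: w k => // -[] w IH k //=.
have := IH k.+1; case: (index_from _ w) => [|j s] //=; exact: ltnW.
Qed.

(** The default 2 makes the empty index admissible. *)
Definition admissible ks := all (ltn 0) ks && (1 < head 2 ks)%N.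

Lemma admissible_index_of_word w : h0_word w -> admissible (index_of_word w).
Proof.
rewrite /admissible index_of_wordE index_from_gt0//=.
case: w => [|[] w]//=; last by rewrite /h0_word andbF.
by move=> _; have := index_from_head 2 w; case: index_from.
Qed.

Lemma tharmonic_index_nilr ks : tharmonic_index ks [::] = word (word_of_index ks).
Proof. by rewrite -prod_z; case: ks. Qed.

Lemma tharmonic_index_nill ls : tharmonic_index [::] ls = word (word_of_index ls).
Proof. by rewrite -prod_z. Qed.

Lemma tharmonic_index_cons k ks l ls :
  tharmonic_index (k :: ks) (l :: ls) =
    z k * tharmonic_index ks (l :: ls) + z l * tharmonic_index (k :: ks) ls
    + (1 - 2 * 'X) *: (z (k + l)%N * tharmonic_index ks ls)
    + ((1 - delta ks * delta ls) * ('X ^+ 2 - 'X)) *: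
        (word (nseq (k + l)%N X) * tharmonic_index ks ls).
Proof. by []. Qed.

Lemma h1_word_zword k w : h1_word (zword k ++ w) = h1_word w.
Proof. by rewrite /h1_word last_cat last_rcons. Qed.

Lemma nilp_zword k w : nilp (zword k ++ w) = false.
Proof. by rewrite /zword cat_rcons; case: k => [|[]]. Qed.

Lemma h1_word_catl u w : ~~ nilp w -> h1_word (u ++ w) = h1_word w.
Proof. by rewrite /h1_word last_cat; case: w. Qed.

Lemma h1_word_of_index ks : h1_word (word_of_index ks).
Proof. by elim: ks => // k ks IH; rewrite /word_of_index /= h1_word_zword. Qed.

Lemma nilp_word_of_index ks : nilp (word_of_index ks) = nilp ks.
Proof. by case: ks => // k ks; rewrite /word_of_index /= nilp_zword. Qed.

Lemma supported_tharmonic_h1 ks ls :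
  supported (fun w => h1_word w && (nilp w == nilp ks && nilp ls))
    (tharmonic_index ks ls).
Proof.
elim: ks ls => [|k ks IHk] ls.
  rewrite tharmonic_index_nill; apply: supported_word.
  by rewrite h1_word_of_index nilp_word_of_index /=.
elim: ls => [|l ls IHl].
  rewrite tharmonic_index_nilr; apply: supported_word.
  by rewrite h1_word_of_index nilp_word_of_index /=.
rewrite tharmonic_index_cons.
have Pz j p b : supported (fun w => h1_word w && (nilp w == b)) p ->
    supported (fun w => h1_word w && (nilp w == false)) (z j * p).
  move=> Pp; apply: supported_wordM; apply: supported_sub Pp => w /andP[hw _].
  by rewrite h1_word_zword nilp_zword hw.
apply: supportedD; first apply: supportedD; first apply: supportedD.
- exact: Pz (IHk (l :: ls)).
- exact: Pz IHl.
- by apply/supportedZ/(Pz _ _ _ (IHk ls)).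
(* The factor 1 - delta delta removes exactly the bare power of x, which is not in h^1. *)
- rewrite /delta; case nkl: (nilp ks && nilp ls).
    by case/andP: nkl => -> ->; rewrite mulr1 subrr mul0r scale0r; exact: supported0.
  apply/supportedZ/supported_wordM; apply: supported_sub (IHk ls) => w /=.
  rewrite nkl => /andP[hw /eqP/negbT nw]; rewrite h1_word_catl// hw /=.
  by rewrite /nilp size_cat addn_eq0 (negbTE nw : (size w == 0)%N = _) andbF.
Qed.

Lemma head_zword k w : (1 < k)%N -> is_Y (head X (zword k ++ w)) = false.
Proof. by case: k => [|[]]. Qed.

Lemma h0_word_of_index ks : admissible ks -> h0_word (word_of_index ks).
Proof.
rewrite /h0_word h1_word_of_index; case: ks => [//|k ks] /andP[_ k1].
by rewrite -[word_of_index _]/(zword k ++ word_of_index ks) head_zword.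
Qed.

Lemma supported_tharmonic_h0 ks ls : admissible ks -> admissible ls ->
  supported h0_word (tharmonic_index ks ls).
Proof.
case: ks => [|k ks]; first by move=> _ al; rewrite tharmonic_index_nill;
  exact/supported_word/h0_word_of_index.
case: ls => [|l ls]; first by move=> ak _; rewrite tharmonic_index_nilr;
  exact/supported_word/h0_word_of_index.
move=> /andP[_ k1] /andP[_ l1] w wT; rewrite /= in k1 l1.
have /andP[hw] := supported_tharmonic_h1 wT; rewrite /h0_word hw /= => _.
suff: supported (fun u => ~~ is_Y (head X u)) (tharmonic_index (k :: ks) (l :: ls)).
  exact.
move=> {w wT hw}.
rewrite tharmonic_index_cons.
have Pz j p : (1 < j)%N -> supported (fun w => ~~ is_Y (head X w)) (z j * p).
  by move=> j1; apply: supported_wordM => w _; rewrite head_zword.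
do 3?[apply: (@supportedD (fun u => ~~ is_Y (head X u)))].
- exact: Pz.
- exact: Pz.
- by apply/supportedZ/Pz/(leq_trans k1)/leq_addr.
- by apply/supportedZ/supported_wordM => w _; case: k k1.
Qed.

Variables (R : realType) (tau : R).

Lemma licoef_nseq m w n : licoef tau (nseq m X ++ w) n = n%:R ^- m * licoef tau w n.
Proof.
elim: m => [|m IH]; first by rewrite expr0 invr1 mul1r.
by rewrite /= IH exprSr invfM mulrAC.
Qed.

Lemma licoef_zword k w n : (0 < k)%N ->
  licoef tau (zword k ++ w) n =
  n%:R ^- k * (series (licoef tau w) n + tau * licoef tau w n).
Proof.
case: k => // k _; rewrite /zword cat_rcons licoef_nseq /= exprSr invfM.
by rewrite -[RHS]mulrA (mulrC n%:R^-1).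
Qed.

Lemma linext_zM k p n : (0 < k)%N ->
  linext tau (fun w => licoef tau w n) (z k * p) =
  n%:R ^- k * (linext tau (fun w => series (licoef tau w) n) p
               + tau * linext tau (fun w => licoef tau w n) p).
Proof.
move=> k0; rewrite linext_wordM -linext_scale -linext_add -linext_scale.
by apply: eq_linext => w; rewrite licoef_zword.
Qed.

Lemma linext_nseqM m p n :
  linext tau (fun w => licoef tau w n) (word (nseq m X) * p) =
  n%:R ^- m * linext tau (fun w => licoef tau w n) p.
Proof.
rewrite linext_wordM -linext_scale.
by apply: eq_linext => w; rewrite licoef_nseq.
Qed.

Lemma linext_harmonic_step h (p q r s : ht) c d :
  linext tau h (p + q + c *: r + d *: s) =
  linext tau h p + linext tau h q + ev tau c * linext tau h r
  + ev tau d * linext tau h s.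
Proof.
by rewrite (linextD _ _ (p + q + c *: r)) (linextD _ _ (p + q)) linextD !linextZ.
Qed.

Let S n w := series (licoef tau w) n.
Let C n w := licoef tau w n.

Lemma linext_tharmonic_cons k ks l ls n : (0 < k)%N -> (0 < l)%N ->
  let L f ks ls := linext tau f (tharmonic_index ks ls) in
  L (C n) (k :: ks) (l :: ls) =
  n%:R ^- k * (L (S n) ks (l :: ls) + tau * L (C n) ks (l :: ls))
  + n%:R ^- l * (L (S n) (k :: ks) ls + tau * L (C n) (k :: ks) ls)
  + (1 - 2 * tau) * (n%:R ^- (k + l) * (L (S n) ks ls + tau * L (C n) ks ls))
  + (1 - (nilp ks)%:R * (nilp ls)%:R) * (tau ^+ 2 - tau)
    * (n%:R ^- (k + l) * L (C n) ks ls).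
Proof.
move=> k0 l0 L; rewrite {1}/L tharmonic_index_cons linext_harmonic_step.
congr (_ + _ + _ * _ + _ * _).
- exact: linext_zM.
- exact: linext_zM.
- by rewrite rmorphB rmorph1 rmorphM rmorph_nat evX.
- by apply: linext_zM; rewrite addn_gt0 k0.
- by rewrite rmorphM !rmorphB rmorph1 rmorphM rmorphXn !ev_delta evX.
- exact: linext_nseqM.
Qed.

(** The right-hand side is the increment of the product of the two partial sums from n to n + 1. The
    hypothesis is the product formula at n for all indices, since the induction on lengths uses it
    for the shorter ones. *)
Lemma linext_tharmonic_coef n ks ls :
  (forall ks ls, all (ltn 0) ks -> all (ltn 0) ls ->
     linext tau (S n) (tharmonic_index ks ls) =
     S n (word_of_index ks) * S n (word_of_index ls)) ->
  all (ltn 0) ks -> all (ltn 0) ls ->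
  linext tau (C n) (tharmonic_index ks ls) =
  S n (word_of_index ks) * C n (word_of_index ls)
  + C n (word_of_index ks) * S n (word_of_index ls)
  + C n (word_of_index ks) * C n (word_of_index ls).
Proof.
move=> IHn; have [->|n0] := posnP n.
  (* At n = 0 the partial sums are empty, and the coefficient of a word is 1 or 0 according to
     whether it is empty. *)
  move=> _ _; rewrite /S /C !series0 mul0r mulr0 !add0r !licoef0.
  rewrite !nilp_word_of_index.
  rewrite (@eq_linext_in _ _ _ (fun=> (nilp ks && nilp ls)%:R)); last first.
    by move=> m /supported_tharmonic_h1 /andP[_ /eqP <-]; rewrite licoef0.
  case: ks ls => [|k ks] [|l ls] /=; last 3 first.
  - by rewrite mulr0 /linext /mmap big1// => m _; rewrite mulr0.
  - by rewrite mul0r /linext /mmap big1// => m _; rewrite mulr0.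
  - by rewrite mul0r /linext /mmap big1// => m _; rewrite mulr0.
  by rewrite big_nil -word_nil linext_word mulr1.
have C1 : C n [::] = 0 by rewrite /C /= -[n]prednK.
have S1 : S n [::] = 1.
  rewrite /S -(prednK n0); elim: n.-1 => [|m IH]; first by rewrite seriesS series0 add0r.
  by rewrite seriesS IH addr0.
have SC k w : (0 < k)%N -> C n (zword k ++ w) = n%:R ^- k * (S n w + tau * C n w).
  exact: licoef_zword.
elim: ks ls => [|k ks IHk] ls.
  by move=> _ pl; rewrite tharmonic_index_nill linext_word S1 C1 !mul0r mul1r !addr0.
elim: ls => [|l ls IHl].
  by move=> pk _; rewrite tharmonic_index_nilr linext_word S1 C1 !mulr0 mulr1 add0r addr0.
move=> pkk pll; have /andP[k0 pk] := pkk; have /andP[l0 pl] := pll.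
rewrite linext_tharmonic_cons// !IHn// IHk// IHl// IHk//.
have -> : word_of_index (k :: ks) = zword k ++ word_of_index ks by [].
have -> : word_of_index (l :: ls) = zword l ++ word_of_index ls by [].
rewrite !SC// exprD invfM.
(* The factor 1 - delta delta is immaterial: C n vanishes on the empty word. *)
have E : (nilp ks)%:R * (nilp ls)%:R *
   (S n (word_of_index ks) * C n (word_of_index ls)
    + C n (word_of_index ks) * S n (word_of_index ls)
    + C n (word_of_index ks) * C n (word_of_index ls)) = 0.
  case: (ks) (ls) => [|? ?] [|? ?] /=; rewrite ?mul0r ?mulr0 ?mul0r//.
  by rewrite C1 !mul0r mulr0 !addr0 mulr0.
move: E; set e := _ * _%:R; set P := n%:R ^- k; set Q := n%:R ^- l.
move: (S n (zword k ++ _)) (S n (zword l ++ _)).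
move: (S n (word_of_index ks)) (S n (word_of_index ls)).
move: (C n (word_of_index ks)) (C n (word_of_index ls)).
move: e P Q => e P Q c c' s s' sk sl E.
apply/eqP; rewrite -subr_eq0; apply/eqP.
transitivity (- (tau ^+ 2 - tau) * P * Q * (e * (s * c' + c * s' + c * c'))).
  by ring.
by rewrite E mulr0.
Qed.

Lemma linext_tharmonic n ks ls : all (ltn 0) ks -> all (ltn 0) ls ->
  linext tau (S n) (tharmonic_index ks ls) =
  S n (word_of_index ks) * S n (word_of_index ls).
Proof.
elim: n ks ls => [|n IHn] ks ls pk pl.
  rewrite /S !series0 mul0r /linext /mmap big1// => m _.
  by rewrite series0 mulr0.
have SS w : S n.+1 w = S n w + C n w by exact: seriesS.
rewrite (eq_linext _ SS) linext_add IHn// linext_tharmonic_coef// !SS.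
by ring.
Qed.

End Harmonic.

(** * Truncated multiple zeta values and convergence at [tau] = 0 *)

Section Convergence.
Variable R : realType.
Implicit Types (ks : seq nat) (w : seq letter).

Lemma sum_tuple_cons (T : finType) n (F : n.+1.-tuple T -> R) :
  \sum_t F t = \sum_(a : T) \sum_(t : n.-tuple T) F [tuple of a :: t].
Proof.
rewrite pair_bigA (reindex (fun p : T * n.-tuple T => [tuple of p.1 :: p.2]))//=.
exists (fun t => (thead t, behead_tuple t)) => [[a t] _|t _] /=.
  by congr pair; apply: val_inj.
by rewrite [RHS]tuple_eta; apply: val_inj.
Qed.

Lemma sum_tuple0 (T : finType) (F : 0.-tuple T -> R) : \sum_t F t = F [tuple].
Proof. by rewrite (big_pred1 [tuple])// => t; symmetry; apply/eqP; exact: tuple0. Qed.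

Lemma licoef_nilS (tau : R) n : licoef tau [::] n.+1 = 0.
Proof. by []. Qed.

Lemma series_licoef_nil (tau : R) n : series (licoef tau [::]) n.+1 = 1.
Proof.
elim: n => [|n IH]; first by rewrite seriesS series0 add0r.
by rewrite seriesS IH addr0.
Qed.

(* The bound M on the largest index makes the induction on ks go through while the
   type 'I_N of the indices stays fixed. *)
Lemma mzv_trunc_path ks N M : (M <= N)%N -> all (ltn 0) ks ->
  \sum_(m : (size ks).-tuple 'I_N | path gtn M [seq val j | j <- m])
     \prod_(i < size ks) (tnth m i).+1%:R ^- nth 0%N ks i =
  series (licoef (0 : R) (word_of_index ks)) M.+1.
Proof.
elim: ks M => [|k ks IH] M MN.
  by move=> _; rewrite series_licoef_nil big_mkcond sum_tuple0 /= big_ord0.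
case/andP=> k0 ks0; have {}k0 : (0 < k)%N := k0.
rewrite big_mkcond sum_tuple_cons.
have -> : word_of_index (k :: ks) = zword k ++ word_of_index ks by [].
(* The term at 0 vanishes since [k] is positive; dropping it matches the shift between an ordinal
   and the summation index it encodes. *)
rewrite /series /= big_nat_recl// licoef_zword// expr0n eqn0Ngt k0 invr0 mul0r add0r.
rewrite big_mkord.
rewrite (big_ord_widen _ (fun i => licoef 0 (zword k ++ word_of_index ks) i.+1) MN).
rewrite [RHS]big_mkcond.
apply: eq_bigr => a _; case: ifP => aM; last first.
  by rewrite big1.
rewrite licoef_zword// mul0r addr0 -IH// 1?ltnW// mulr_sumr [RHS]big_mkcond.
apply: eq_bigr => t _ /=; case: ifP => // _.
rewrite big_ord_recl /= tnth0; congr (_ * _).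
by apply: eq_bigr => i _; rewrite tnthS.
Qed.

Lemma mzv_truncE ks N : all (ltn 0) ks ->
  mzv_trunc R ks N = series (licoef 0 (word_of_index ks)) N.+1.
Proof.
move=> ks0; rewrite -(mzv_trunc_path (leqnn N))//.
apply: eq_bigl => m; case: (tval m) => //= a s.
by rewrite ltn_ord.
Qed.

Definition invsqrt (n : nat) : R := (Num.sqrt n%:R)^-1.

Lemma sqrtnS_sqr n : Num.sqrt n.+1%:R ^+ 2 = Num.sqrt n%:R ^+ 2 + 1 :> R.
Proof. by rewrite !sqr_sqrtr ?ler0n// natr1. Qed.

Lemma sqrtn_gt0 n : (0 < n)%N -> 0 < Num.sqrt n%:R :> R.
Proof. by move=> n0; rewrite sqrtr_gt0 ltr0n. Qed.

Lemma invsqrt_ge0 n : 0 <= invsqrt n.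
Proof. by rewrite invr_ge0 sqrtr_ge0. Qed.

(* Telescoping: sqrt (n+1) - sqrt n >= 1 / (2 sqrt (n+1)). *)
Lemma sum_invsqrt_le n : \sum_(1 <= m < n.+1) invsqrt m <= 2 * Num.sqrt n%:R.
Proof.
elim: n => [|n IH]; first by rewrite big_geq// mulr_ge0 ?sqrtr_ge0.
rewrite big_nat_recr//=; apply: le_trans (lerD IH (lexx _)) _.
rewrite /invsqrt; have s'0 := sqrtn_gt0 (ltn0Sn n).
have s0 : 0 <= Num.sqrt n%:R :> R by exact: sqrtr_ge0.
move: (sqrtnS_sqr n) s0 s'0; move: (Num.sqrt n.+1%:R) (Num.sqrt n%:R) => s' s E s0 s'0.
have us : s'^-1 * s' = 1 by rewrite mulVf// gt_eqF.
have u0 : 0 <= s'^-1 by rewrite invr_ge0 ltW.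
move: (s'^-1) us u0 => u us u0.
(* Using s'^2 = s^2 + 1 and u s' = 1, this square expands to 2 s' - 2 s - u. *)
have : 0 <= u * (s' - s) ^+ 2 by rewrite mulr_ge0// sqr_ge0.
have -> : u * (s' - s) ^+ 2 = (u * s') * (s' - 2 * s) + u * s ^+ 2 by ring.
have -> : s ^+ 2 = s' ^+ 2 - 1 by rewrite E addrK.
have -> : u * (s' ^+ 2 - 1) = (u * s') * s' - u by ring.
rewrite us; lra.
Qed.

(* Telescoping: with f = 1 / sqrt, f (n+1) ^ 3 <= 2 (f n - f (n+1)). *)
Lemma sum_invsqrt3_le n : \sum_(1 <= m < n.+1) invsqrt m / m%:R <= 3.
Proof.
suff : \sum_(1 <= m < n.+1) invsqrt m / m%:R <= 3 - 2 * invsqrt n.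
  by move/le_trans; apply; rewrite gerBl mulr_ge0// invsqrt_ge0.
elim: n => [|[|n] IH].
- by rewrite big_geq// /invsqrt sqrtr0 invr0 mulr0 subr0.
- by rewrite big_nat1 /invsqrt sqrtr1 !invr1; lra.
rewrite big_nat_recr//=; apply: le_trans (lerD IH (lexx _)) _.
have -> : n.+2%:R^-1 = invsqrt n.+2 ^+ 2 :> R by rewrite exprVn sqr_sqrtr// ler0n.
have : invsqrt n.+1 ^+ 2 - invsqrt n.+2 ^+ 2 = invsqrt n.+1 ^+ 2 * invsqrt n.+2 ^+ 2.
  have := sqrtnS_sqr n.+1; rewrite /invsqrt !exprVn => ->.
  have : Num.sqrt n.+1%:R ^+ 2 > 0 :> R by rewrite exprn_gt0// sqrtn_gt0.
  move: (_ ^+ 2) => x x0; field; rewrite !gt_eqF//; lra.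
have : 0 < invsqrt n.+1 by rewrite invr_gt0 sqrtn_gt0.
have : 0 < invsqrt n.+2 by rewrite invr_gt0 sqrtn_gt0.
move: (invsqrt n.+1) (invsqrt n.+2) => u v v0 u0 E.
have vu : v <= u.
  have : 0 <= u ^+ 2 * v ^+ 2 by rewrite mulr_ge0// sqr_ge0.
  by rewrite -E subr_ge0 ler_pXn2r// nnegrE ltW.
suff : v * v ^+ 2 <= 2 * (u - v) by lra.
(* Multiplying by u + v brings in u^2 - v^2 = u^2 v^2; what remains is v (u + v) <= 2 u^2, true as v
   <= u. *)
have uv0 : 0 < u + v by rewrite addr_gt0.
rewrite -(ler_pM2r uv0).
have -> : 2 * (u - v) * (u + v) = 2 * (u ^+ 2 - v ^+ 2) by ring.
rewrite E -subr_ge0.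
have -> : 2 * (u ^+ 2 * v ^+ 2) - v * v ^+ 2 * (u + v) =
  v ^+ 2 * ((u - v) * (u + v) + u * (u - v)) by ring.
apply: mulr_ge0; first exact: sqr_ge0.
by apply: addr_ge0; apply: mulr_ge0; rewrite ?subr_ge0// ltW.
Qed.

(** A bound of order n^(-1/2) is stable under both letters: its partial sums are of order n^(1/2),
    and the division by n restores the exponent. This avoids tracking powers of logarithms. *)
Lemma licoef_le_invsqrt w :
  exists2 A : R, 0 <= A & forall n, (0 < n)%N -> licoef 0 w n <= A * invsqrt n.
Proof.
elim: w => [|a w [A A0 wA]].
  by exists 0 => // -[]// n _; rewrite licoef_nilS mul0r.
have c0 m : 0 <= licoef (0 : R) w m by exact: licoef_ge0.
(* The 1 covers the term of index 0 in the partial sum, and 2 A comes from [sum_invsqrt_le]. *)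
exists (1 + 2 * A) => [|n n0]; first by rewrite addr_ge0// mulr_ge0.
have n0R : 0 < n%:R :> R by rewrite ltr0n.
have n1R : 1 <= n%:R :> R by rewrite ler1n.
have bs : invsqrt n = Num.sqrt n%:R / n%:R.
  by rewrite -[in X in _ / X](sqr_sqrtr (ler0n R n)) expr2 invfM mulVKf// gt_eqF// sqrtn_gt0.
rewrite licoef_cons; case: a => /=.
  apply: le_trans (_ : licoef 0 w n <= _).
    by rewrite ler_pdivrMr// ler_peMr.
  apply: le_trans (wA n n0) _; apply: ler_wpM2r; first exact: invsqrt_ge0.
  lra.
rewrite mul0r addr0 bs mulrA ler_pM2r ?invr_gt0//.
case: n n0 {n0R bs} n1R => // n _ n1R; rewrite /series /= big_nat_recl//.
have s1 : 1 <= Num.sqrt n.+1%:R :> R by have := ler_wsqrtr n1R; rewrite sqrtr1.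
have c1 : licoef 0 w 0 <= 1 :> R by rewrite licoef0; case: nilp.
rewrite mulrDl mul1r; apply: lerD; first exact: le_trans c1 s1.
have -> : \sum_(0 <= i < n) licoef 0 w i.+1 = \sum_(1 <= i < n.+1) licoef 0 w i :> R.
  by rewrite big_add1.
apply: le_trans (_ : \sum_(1 <= i < n.+1) A * invsqrt i <= _).
  rewrite big_nat_cond [leRHS]big_nat_cond; apply: ler_sum => i /andP[/andP[i0 _] _].
  exact: wA.
rewrite -mulr_sumr -mulrA mulrCA; apply: ler_wpM2l => //.
apply: le_trans (sum_invsqrt_le n) _; apply: ler_wpM2l => //.
by rewrite ler_wsqrtr// ler_nat.
Qed.

Lemma nondecreasing_series_ge0 (f : nat -> R) :
  (forall n, 0 <= f n) -> nondecreasing_seq (series f).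
Proof. by move=> f0; apply: nondecreasing_series => n _ _. Qed.

(** The leading x gains a factor 1/n over the bound n^(-1/2), so the nonnegative terms are dominated
    by a multiple of n^(-3/2). *)
Lemma cvg_series_licoef0 w : h0_word w -> cvgn (series (licoef (0 : R) w)).
Proof.
move=> hw; apply: nondecreasing_is_cvgn.
  by apply: nondecreasing_series_ge0 => n; apply: licoef_ge0.
case: w hw => [|[] w]; last by rewrite /h0_word andbF.
  move=> _; exists 1 => _ [n _ <-]; case: n => [|n]; first by rewrite series0.
  by rewrite series_licoef_nil.
move=> _; have [A A0 wA] := licoef_le_invsqrt w.
exists (A * 3) => _ [n _ <-]; case: n => [|n].
  by rewrite series0 mulr_ge0.
rewrite /series /= big_nat_recl//= invr0 mulr0 add0r.
have -> : \sum_(0 <= i < n) licoef 0 w i.+1 / i.+1%:R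
          = \sum_(1 <= i < n.+1) licoef 0 w i / i%:R :> R by rewrite big_add1.
apply: le_trans (_ : \sum_(1 <= i < n.+1) A * (invsqrt i / i%:R) <= _).
  rewrite big_nat_cond [leRHS]big_nat_cond; apply: ler_sum => i /andP[/andP[i0 _] _].
  by rewrite mulrA; apply: ler_wpM2r; [rewrite invr_ge0 ler0n | exact: wA].
by rewrite -mulr_sumr; apply: ler_wpM2l => //; exact: sum_invsqrt3_le.
Qed.

End Convergence.

(** * Interpolated zeta values as limits, and their product formulas *)

Section Limits.
Variables (R : realType) (tau : R).
Implicit Types (ks : seq nat) (u v w : seq letter) (b : seq bool).

Lemma size_fill_from k b ks : (size (fill_from k b ks) <= (size ks).+1)%N.
Proof. by elim: ks k b => [|k' ks IH] k [|[] b] //=; first [exact: leqW (IH _ _) | exact: IH]. Qed.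

Lemma admissible_fill b ks : admissible ks -> admissible (fill b ks).
Proof.
case: ks => // k ks /andP[/andP[_ ks0] k1]; rewrite [fill _ _]/=.
elim: ks k b ks0 k1 => [|k' ks IH] k [|a b] /= ks0 k1.
- by rewrite /admissible /= k1 ltnW.
- by rewrite /admissible /=; case: a; rewrite /= k1 ltnW.
- by rewrite /admissible /= k1 ks0 ltnW.
case/andP: ks0 => k'0 ks0; case: a; first by apply: IH => //; exact: ltn_addr.
rewrite /admissible /= k1 ltnW//= andbT.
(* After the first comma the remaining parts need only be positive, so a new induction runs with
   that weaker condition. *)
elim: ks k' b k'0 ks0 {IH} => [|k'' ks IH] k' [|a b] /= k'0 ks0.
- by rewrite k'0.
- by case: a; rewrite /= k'0.
- by rewrite k'0.
case/andP: ks0 => k''0 ks0; case: a; first by apply: IH => //; exact: ltn_addr.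
by rewrite /= k'0 IH.
Qed.

Lemma licoef_zword0 k w n : (0 < k)%N ->
  licoef 0 (zword k ++ w) n = n%:R ^- k * series (licoef 0 w) n :> R.
Proof. by move=> k0; rewrite licoef_zword// mul0r addr0. Qed.

Lemma licoef_zwordD k l w n : (0 < k)%N -> (0 < l)%N ->
  licoef tau (zword (k + l) ++ w) n = n%:R ^- k * licoef tau (zword l ++ w) n.
Proof.
by move=> k0 l0; rewrite !licoef_zword ?addn_gt0 ?k0// exprD invfM mulrA.
Qed.

(* A comma after k sums over strictly smaller indices, and a plus merges k with the
   next part: these are the two terms of the recursion for [licoef]. *)
Lemma sum_fill_from k ks n : (0 < k)%N -> all (ltn 0) ks ->
  \sum_(b : (size ks).-tuple bool)
     licoef 0 (word_of_index (fill_from k b ks)) n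
     * tau ^+ ((size ks).+1 - size (fill_from k b ks)) =
  licoef tau (word_of_index (k :: ks)) n.
Proof.
elim: ks k n => [|k' ks IH] k n k0.
  move=> _; rewrite sum_tuple0 /= mulr1 /word_of_index /= !licoef_zword//.
  (* The two sides differ by [tau] times the unit sequence over n^k, and at n = 0 that quotient is 0
     by the convention on inverses. *)
  rewrite mul0r addr0; case: n => [|n]; last by rewrite licoef_nilS mulr0 addr0.
  by rewrite expr0n eqn0Ngt k0 invr0 !mul0r.
case/andP=> k'0 ks0; rewrite sum_tuple_cons big_bool /=.
have -> : word_of_index [:: k, k' & ks] = zword k ++ word_of_index (k' :: ks) by [].
rewrite [RHS]licoef_zword// mulrDr mulrCA addrC; congr (_ + _).
  rewrite /series /= mulr_sumr.
  under [RHS]eq_bigr do rewrite -IH// mulr_sumr.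
  rewrite exchange_big; apply: eq_bigr => b _; rewrite subSS.
  rewrite -mulr_sumr -mulr_suml mulrA; congr (_ * _).
  exact: licoef_zword0.
rewrite -[word_of_index (k' :: ks)]/(zword k' ++ word_of_index ks) -licoef_zwordD//.
rewrite -[zword _ ++ word_of_index ks]/(word_of_index (k + k' :: ks)) -IH ?addn_gt0 ?k0//.
rewrite mulr_sumr; apply: eq_bigr => b _.
by rewrite subSn ?size_fill_from// exprS mulrCA.
Qed.

Lemma sum_fill ks n : admissible ks ->
  \sum_(b : (size ks).-1.-tuple bool)
     licoef 0 (word_of_index (fill b ks)) n * tau ^+ (size ks - size (fill b ks)) =
  licoef tau (word_of_index ks) n.
Proof.
case: ks => [|k ks] /andP[ks0 _]; first by rewrite sum_tuple0 mulr1.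
by have /andP[k0 {}ks0] := ks0; exact: sum_fill_from.
Qed.

Local Open Scope classical_set_scope.

Lemma cvg_mzv ks : admissible ks ->
  series (licoef 0 (word_of_index ks)) @ \oo --> mzv R ks.
Proof.
move=> aks; have /andP[ks0 _] := aks.
have E : mzv_trunc R ks = [sequence series (licoef 0 (word_of_index ks)) n.+1]_n.
  by apply/boolp.funext => N; rewrite mzv_truncE.
have c := cvg_series_licoef0 (R := R) (h0_word_of_index aks).
rewrite /mzv E; set u := series _ in c *.
have L : [sequence u n.+1]_n @ \oo --> limn u by rewrite cvg_shiftS.
by rewrite (cvg_lim _ L).
Qed.

(** By [sum_fill] the series at [tau] is a finite combination of series at 0, which converge to
    multiple zeta values. *)
Lemma cvg_zetat w : h0_word w ->
  series (licoef tau w) @ \oo --> (zetat R (index_of_word w)).[tau].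
Proof.
move=> hw; have aks := admissible_index_of_word hw.
have /andP[/index_of_wordK wE _] := hw; rewrite -[in licoef tau w]wE.
move: (index_of_word w) aks => ks aks {w hw wE}.
have -> : series (licoef tau (word_of_index ks)) = fun N =>
    \sum_(b : (size ks).-1.-tuple bool)
      series (licoef 0 (word_of_index (fill b ks))) N
      * tau ^+ (size ks - size (fill b ks)).
  apply/boolp.funext => N; rewrite /series /=.
  under eq_bigr do rewrite -sum_fill//.
  by rewrite exchange_big; apply: eq_bigr => b _; rewrite mulr_suml.
rewrite /zetat horner_sum.
under eq_bigr do rewrite hornerZ hornerXn.
apply: cvg_big => [|b _]; first exact: add_continuous.
by apply: cvgMr_tmp; apply/cvg_mzv/admissible_fill.
Qed.

(** With F, G, H the partial sums of f, g and their Cauchy product, nonnegativity gives H(n) <=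
    F(n+1) G(n) and F(n) G(n) <= H(2n). *)
Lemma cvg_series_conv (f g : nat -> R) (a b l : R) :
  (forall n, 0 <= f n) -> (forall n, 0 <= g n) ->
  series f @ \oo --> a -> series g @ \oo --> b ->
  series (conv f g) @ \oo --> l -> l = a * b.
Proof.
move=> f0 g0 fa gb fgl.
have conv0 n : 0 <= conv f g n by apply: sumr_ge0 => i _; exact: mulr_ge0.
have fgab : (fun n => series f n * series g n) @ \oo --> a * b by exact: cvgM.
have E n : series (conv f g) n = \sum_(i < n.+1) f i * series g (n - i)%N.
  rewrite -[RHS]/(conv f (series g) n) convC conv_series.
  by apply: eq_series => i; rewrite convC.
have ndf := nondecreasing_series_ge0 f0; have ndg := nondecreasing_series_ge0 g0.
have ndfg := nondecreasing_series_ge0 conv0.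
apply/eqP; rewrite eq_le; apply/andP; split.
  apply: (ler_cvg_to fgl (cvgM (_ : [sequence series f n.+1]_n @ \oo --> a) gb)).
    by rewrite cvg_shiftS.
  near=> n; rewrite E /= /series /= big_mkord mulr_suml; apply: ler_sum => i _.
  by apply: ler_wpM2l => //; apply: ndg; exact: leq_subr.
have -> : l = limn (series (conv f g)) by apply/esym/cvg_lim.
have cfg : cvgn (series (conv f g)) by apply: cvgP fgl.
have -> : a * b = limn (fun n => series f n * series g n) by apply/esym/cvg_lim.
apply: limr_le; first exact: cvgP fgab.
(* In H(2n), keep only the terms with i < n; there 2n - i >= n, so G(2n - i) >= G(n). *)
near=> n; apply: le_trans (nondecreasing_cvgn_le ndfg cfg n.*2).
rewrite E; have nn : (n <= n.*2.+1)%N by rewrite -addnn leqW// leq_addr.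
rewrite [series f n]/series /= big_mkord (big_ord_widen _ f nn) big_mkcond.
rewrite mulr_suml; apply: ler_sum => i _; case: ifP => [ni|_].
  by apply: ler_wpM2l => //; apply: ndg; move: (nat_of_ord i) ni => j nj;
    rewrite -addnn -addnBA ?leq_addr// ltnW.
by rewrite mul0r mulr_ge0// series_ge0.
Unshelve. all: by end_near. Qed.

Definition zeta_at w : R := (zetat R (index_of_word w)).[tau].

Lemma Zt_horner p : (Zt R p).[tau] = linext tau zeta_at p.
Proof. by rewrite horner_sum; apply: eq_bigr => m _; rewrite hornerM. Qed.

Lemma cvg_linext (p : ht) : supported h0_word p ->
  (fun N => linext tau (fun w => series (licoef tau w) N) p) @ \oo -->
  linext tau zeta_at p.
Proof.
move=> hp; rewrite /linext /mmap big_seq.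
under boolp.eq_fun do rewrite big_seq.
apply: cvg_big => [|m mp]; first exact: add_continuous.
by apply: cvgMl_tmp; apply/cvg_zetat/hp.
Qed.

(** The sign of [tau] makes all coefficients nonnegative, as the multiplication of the sums by
    [cvg_series_conv] requires. *)
Lemma zeta_at_shuffle u v : 0 <= tau -> h0_word u -> h0_word v ->
  linext tau zeta_at (tshuffle_word u v) = zeta_at u * zeta_at v.
Proof.
move=> tau0 hu hv.
apply: (@cvg_series_conv (licoef tau u) (licoef tau v)).
- by move=> n; exact: licoef_ge0.
- by move=> n; exact: licoef_ge0.
- exact: cvg_zetat.
- exact: cvg_zetat.
have /andP[h1u _] := hu; have /andP[h1v _] := hv.
have -> : series (conv (licoef tau u) (licoef tau v)) =
    fun N => linext tau (fun w => series (licoef tau w) N) (tshuffle_word u v).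
  apply/boolp.funext => N; rewrite linext_sumr; apply: eq_bigr => n _.
  exact: conv_licoef.
by apply/cvg_linext/supported_tshuffle_h0.
Qed.

(** The product formula holds for every partial sum, so it passes to the limit. *)
Lemma zeta_at_harmonic u v : h0_word u -> h0_word v ->
  linext tau zeta_at (tharmonic_index (index_of_word u) (index_of_word v)) =
  zeta_at u * zeta_at v.
Proof.
move=> hu hv; have au := admissible_index_of_word hu.
have av := admissible_index_of_word hv.
have := cvg_linext (supported_tharmonic_h0 au av).
have /andP[pu _] := au; have /andP[pv _] := av.
under boolp.eq_fun do rewrite linext_tharmonic//.
have /andP[/index_of_wordK -> _] := hu; have /andP[/index_of_wordK -> _] := hv.
move=> lim_h; apply: cvg_unique lim_h _; first exact: norm_hausdorff.
by rewrite /=; apply: cvgM; exact: cvg_zetat.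
Qed.

End Limits.

(** * From words to elements of h^0, and from natural values of t to polynomials *)

Lemma supported_in_h0 p : in_h0 p -> supported h0_word p.
Proof.
case=> c [q ->]; apply: supportedD.
  move=> m /(fsubsetP (msuppC_le _)); rewrite in_fset1 => /eqP ->.
  by rewrite fm1.
apply: supportedM => _ m /msuppM_le[x [y [xX _ ->]]].
rewrite msuppU1 in_fset1 => /eqP ->; move: xX; rewrite msuppU1 in_fset1 => /eqP ->.
by rewrite /mmul /= fmmulE /h0_word /h1_word /= last_cat.
Qed.

Lemma linext_bilinear_ext (R : realType) (tau : R) h f (p q : ht) :
  linext tau h (bilinear_ext f p q) =
  \sum_(u <- msupp p) \sum_(v <- msupp q) ev tau (p@_u * q@_v) * linext tau h (f u v).
Proof.
rewrite linext_sum; apply: eq_bigr => u _; rewrite linext_sum.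
by apply: eq_bigr => v _; rewrite linextZ.
Qed.

(** The integers below [size p] are already more roots than the degree allows. Natural points also
    meet the condition [0 <= tau]. *)
Lemma poly_eq0_nat (R : realType) (p : {poly R}) :
  (forall n : nat, p.[n%:R] = 0) -> p = 0.
Proof.
move=> p0; apply: (@roots_geq_poly_eq0 _ p [seq i%:R | i <- iota 0 (size p)]).
- by apply/allP => _ /mapP[i _ ->]; rewrite rootE p0.
- by rewrite map_inj_uniq ?iota_uniq//; exact: mulrIn (oner_neq0 _).
- by rewrite size_map size_iota.
Qed.

Theorem theorem2p6 (R : realType) (w1 w2 : ht) :
  in_h0 w1 -> in_h0 w2 -> Zt R (tshuffle w1 w2 - tharmonic w1 w2) = 0.
Proof.
move=> /supported_in_h0 h1 /supported_in_h0 h2; apply: poly_eq0_nat => n.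
rewrite Zt_horner linextB !linext_bilinear_ext; apply/eqP; rewrite subr_eq0.
(* Both products expand over the same pairs of words with the same coefficients, and each pair
   contributes the product of its two zeta values. *)
apply/eqP/eq_big_seq => u /h1 hu; apply: eq_big_seq => v /h2 hv.
by rewrite zeta_at_shuffle// zeta_at_harmonic.
Qed.
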